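(* For allocating contiguous blocks of indivisible goods to $n=2$ agents: the price of fairness with respect to egalitarian welfare equals $1$ both for MMS and for PROP1, i.e. $\mathrm{PoF}(\mathsf{EW},\mathrm{MMS})=\mathrm{PoF}(\mathsf{EW},\mathrm{PROP1})=1$; and the price of fairness with respect to utilitarian welfare equals $\frac32$ both for MMS and for PROP1, i.e. $\mathrm{PoF}(\mathsf{UW},\mathrm{MMS})=\mathrm{PoF}(\mathsf{UW},\mathrm{PROP1})=\frac32$.
   Context: A fair-goods instance $\mathcal I$ with two agents consists of agents $N=\{1,2\}$, indivisible items $E=\{e_1,\dots,e_m\}$ placed on a path in this order, and for each agent $i$ an additive valuation $v_i$ (i.e. $v_i(S)=\sum_{e\in S}v_i(e)$) with $v_i(e)\ge 0$ for all $e\in E$, normalized so that $v_i(\emptyset)=0$, $v_i(E)=1$. A bundle is connected if it is a set of consecutive items (the empty set is allowed). An allocation $\mathbf A=(A_1,A_2)$ is a partition of $E$ into two disjoint connected (possibly empty) bundles, $A_i$ being given to agent $i$ (either agent's bundle may be the left one). Its utilitarian welfare is $\mathsf{UW}(\mathbf A)=v_1(A_1)+v_2(A_2)$ and its egalitarian welfare is $\mathsf{EW}(\mathbf A)=\min\{v_1(A_1),v_2(A_2)\}$. The maximin share of agent $i$ is $\mathsf{MMS}_i=\max_{(X_1,X_2)}\min\{v_i(X_1),v_i(X_2)\}$ over all partitions of $E$ into two connected (possibly empty) bundles. An allocation is MMS if $v_i(A_i)\ge\mathsf{MMS}_i$ for both $i$. An allocation is PROP1 if for each $i$, either $v_i(A_i)\ge\frac12$,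 or there is $e\in E\setminus A_i$ such that $A_i\cup\{e\}$ is connected and $v_i(A_i\cup\{e\})\ge\frac12$. For $W\in\{\mathsf{UW},\mathsf{EW}\}$ and $F\in\{\mathrm{MMS},\mathrm{PROP1}\}$, $\mathrm{PoF}(W,F)=\sup_{\mathcal I}\min_{\mathbf A}\frac{\mathsf{OPT}_W(\mathcal I)}{W(\mathbf A)}$, where $\mathsf{OPT}_W(\mathcal I)$ is the maximum of $W$ over all allocations of $\mathcal I$, the supremum is over all fair-goods instances with two agents, and the minimum is over all allocations $\mathbf A$ of $\mathcal I$ satisfying $F$; conventions: $c/0=+\infty$ for $c>0$ and $0/0=1$. *)

(* Defs.v *)
From mathcomp Require Import all_boot all_order all_algebra.
From mathcomp Require Import all_classical all_reals all_analysis.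

Set Implicit Arguments.
Unset Strict Implicit.
Unset Printing Implicit Defensive.

Import Order.TTheory GRing.Theory Num.Theory.
Local Open Scope classical_set_scope.
Local Open Scope ring_scope.

(* A fair-goods instance with two agents: the agents are the elements of 'I_2
   and the items are the elements of 'I_nitems, in their order on the path.
   Normalization forces nitems to be positive. *)
Record instance (R : realType) := Instance {
  nitems : nat ;
  item_val : 'I_2 -> 'I_nitems -> R ;
  item_val_ge0 : forall i e, 0 <= item_val i e ;
  item_val_norm : forall i, \sum_e item_val i e = 1
}.

Definition agent1 : 'I_2 := ord0.
Definition agent2 : 'I_2 := ord_max.

Section Defs.
Variable R : realType.

Definition value (I : instance R) (i : 'I_2) (S : {set 'I_(nitems I)}) : R :=
  \sum_(e in S) item_val i e.

Definition connected_bundle m (S : {set 'I_m}) : bool :=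
  [exists a : 'I_m.+1, [exists b : 'I_m.+1,
     S == [set e : 'I_m | (a <= e < b)%N]%SET]].

(* The bundle of agent i is A i; only those A satisfying is_allocation below
   are partitions of the items into connected bundles. *)
Definition bundles (I : instance R) := {ffun 'I_2 -> {set 'I_(nitems I)}}.

Definition is_allocation (I : instance R) (A : bundles I) : bool :=
  [&& [disjoint A agent1 & A agent2],
      (A agent1 :|: A agent2 == [set: 'I_(nitems I)])%SET &
      [forall i, connected_bundle (A i)]].

Definition UW (I : instance R) (A : bundles I) : R :=
  value agent1 (A agent1) + value agent2 (A agent2).

Definition EW (I : instance R) (A : bundles I) : R :=
  Num.min (value agent1 (A agent1)) (value agent2 (A agent2)).

(* The maxima in MMS_share and OPT range over nonnegative values and over a
   nonempty set of allocations, so the default value 0 of the iterated maximum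
   does not affect them. *)
Definition MMS_share (I : instance R) (i : 'I_2) : R :=
  \big[Num.max/0]_(X : bundles I | is_allocation X)
     Num.min (value i (X agent1)) (value i (X agent2)).

Definition MMS (I : instance R) (A : bundles I) : bool :=
  [forall i, MMS_share I i <= value i (A i)].

Definition PROP1 (I : instance R) (A : bundles I) : bool :=
  [forall i, (2^-1 <= value i (A i)) ||
     [exists e, [&& e \notin A i, connected_bundle (e |: A i)%SET &
                    2^-1 <= value i (e |: A i)%SET]]].

Definition welfare := forall I : instance R, bundles I -> R.
Definition fairness := forall I : instance R, bundles I -> bool.

Definition OPT (W : welfare) (I : instance R) : R :=
  \big[Num.max/0]_(A : bundles I | is_allocation A) W I A.

(* c / w for c, w >= 0, with c / 0 = +oo when c > 0, and 0 / 0 = 1. *)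
Definition welfare_ratio (c w : R) : \bar R :=
  if w == 0 then (if c == 0 then 1%E else +oo%E) else (c / w)%:E.

(* Equal to +oo if no allocation satisfies F. *)
Definition instance_price (W : welfare) (F : fairness) (I : instance R)
    : \bar R :=
  \big[Order.min/+oo%E]_(A : bundles I | is_allocation A && F I A)
     welfare_ratio (OPT W I) (W I A).

Definition PoF (W : welfare) (F : fairness) : \bar R :=
  ereal_sup [set instance_price W F I | I in [set: instance R]].

End Defs.

(* Main.v *)
(* An allocation of a path between two agents is a cut of the path together with
   an orientation, and the two orientations of a cut have utilitarian welfares
   that add up to 2. For MMS, a suitably oriented optimal cut of the agent with
   the larger share has utilitarian welfare at least 1 and egalitarian welfare
   at least both shares; in particular every EW-optimal allocation is MMS. For
   PROP1, either the median items of the agents differ and some allocation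
   gives both agents 1/2, or they share a median item: then all four
   allocations that cut right before or after it are PROP1, and moving any cut
   towards it does not decrease the egalitarian welfare. An unfair allocation
   gives some agent less than 1/2, so has utilitarian welfare below 3/2, which
   is attained in the limit by a three-item instance. *)
Require Import Defs.
From mathcomp Require Import all_boot all_order all_algebra.
From mathcomp Require Import all_classical all_reals all_analysis.
From mathcomp Require Import ring lra zify.

Set Implicit Arguments.
Unset Strict Implicit.
Unset Printing Implicit Defensive.

Import Order.TTheory GRing.Theory Num.Theory.
Local Open Scope ring_scope.

(** * The two agents, exchanged by [rev_ord] *)

Lemma agentP (P : 'I_2 -> Prop) (i : 'I_2) :
  P i -> P (rev_ord i) -> forall j, P j.
Proof.
move=> Pi Pr j; have : (j == i) || (j == rev_ord i).
  by rewrite -!val_eqE /=; case: i j {Pi Pr} => [[|[|//]] hi] [[|[|//]] hj].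
by case/orP => /eqP ->.
Qed.

Lemma rev_agent1 : rev_ord agent1 = agent2.
Proof. exact/val_inj. Qed.

Lemma agent_cases (i : 'I_2) : i = agent1 \/ i = agent2.
Proof.
move: i; apply: (agentP (i := agent1)); first by left.
by right; apply: rev_agent1.
Qed.

Lemma rev_ord_neq (i : 'I_2) : (rev_ord i == i) = false.
Proof. by case: i => [[|[|//]] h]; apply/eqP => /(congr1 val). Qed.

(** * Allocations as oriented cuts of the path *)

Section Cuts.
Variables (R : realType) (I : instance R).
Implicit Types (i j : 'I_2) (k : nat) (S : {set 'I_(nitems I)})
  (A B : bundles I).
Local Notation m := (nitems I).

Definition prefix_set k : {set 'I_m} := [set e : 'I_m | (e < k)%N]%SET.
Definition cut i k : bundles I :=
  [ffun j => if j == i then prefix_set k else (~: prefix_set k)%SET].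

Lemma cutE i k : cut i k i = prefix_set k.
Proof. by rewrite ffunE eqxx. Qed.

Lemma cut_rev i k : cut i k (rev_ord i) = (~: prefix_set k)%SET.
Proof. by rewrite ffunE rev_ord_neq. Qed.

Lemma cut_revl i k : cut (rev_ord i) k i = (~: prefix_set k)%SET.
Proof. by rewrite -{2}[i]rev_ordK cut_rev. Qed.

Lemma prefix_connected k : (k <= m)%N -> connected_bundle (prefix_set k).
Proof.
move=> km; apply/existsP; exists ord0; apply/existsP.
exists (Ordinal (n:=m.+1) (m:=k) km).
by apply/eqP/setP => e; rewrite !inE.
Qed.

Lemma suffix_connected k :
  (k <= m)%N -> connected_bundle (~: prefix_set k)%SET.
Proof.
move=> km; apply/existsP; exists (Ordinal (n:=m.+1) (m:=k) km).
apply/existsP; exists ord_max.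
by apply/eqP/setP => e; rewrite !inE /= ltn_ord andbT -leqNgt.
Qed.

Lemma is_allocationP A : reflect (A agent2 = (~: A agent1)%SET /\
    forall i, connected_bundle (A i)) (is_allocation A).
Proof.
apply: (iffP and3P) => [[d /eqP c /forallP h]|[e h]]; split => //.
- apply/setP => x; rewrite inE.
  have := finset.in_setT x; rewrite -c inE.
  have := disjointFr d (x := x).
  by case: (x \in A agent1) => [/(_ isT) -> //|_ /= ->].
- by rewrite e finset.disjoints_subset finset.setCK.
- by rewrite e finset.setUCr.
- exact/forallP.
Qed.

Lemma cut_allocation i k : (k <= m)%N -> is_allocation (cut i k).
Proof.
move=> km; apply/is_allocationP; split.
  have [->|->] := agent_cases i.
  - by rewrite !ffunE.
  - by rewrite !ffunE finset.setCK.
move=> j; rewrite ffunE.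
by case: ifP => _; [apply: prefix_connected|apply: suffix_connected].
Qed.

(** If agent 1's interval [[a, b)] is nonempty and touches neither end of the path, then items [0]
    and [b] belong to agent 2 while [a], between them, does not, so agent 2's bundle is not
    connected. *)
Lemma allocation_cut A : is_allocation A ->
  exists i k, (k <= m)%N /\ A = cut i k.
Proof.
move=> /is_allocationP [e c].
have eqA i k : A i = prefix_set k -> A = cut i k.
  move=> Ai; have Ac j : A (rev_ord j) = (~: A j)%SET.
    have [->|->] := agent_cases j; first by rewrite rev_agent1.
    by rewrite -rev_agent1 rev_ordK rev_agent1 e finset.setCK.
  by apply/ffunP; apply: (@agentP _ i); rewrite ?cutE ?cut_rev ?Ac ?Ai.
have /existsP [a /existsP [b /eqP A1]] := c agent1.
have /existsP [x /existsP [y /eqP A2]] := c agent2.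
case: (leqP b a) => [ba|ab].
  exists agent1, 0%N; split=> //; apply: eqA; rewrite A1; apply/setP => z.
  rewrite !inE; lia.
case: (posnP a) => [a0|a0].
  exists agent1, b; split; first by rewrite -ltnS.
  by apply: eqA; rewrite A1; apply/setP => z; rewrite !inE; lia.
have bm := ltn_ord b.
case: (ltnP b m) => [{}bm|mb]; last first.
  exists agent2, a; split; first by rewrite -ltnS.
  apply: eqA; rewrite e A1; apply/setP => z; rewrite !inE.
  have := ltn_ord z; lia.
have am : (a < m)%N by lia.
have m0 : (0 < m)%N by lia.
have H (z : 'I_m) : (x <= z < y)%N = ~~ (a <= z < b)%N.
  by have /setP/(_ z) := e; rewrite A1 A2 !inE.
have := H (Ordinal am); have := H (Ordinal bm); have := H (Ordinal m0).
rewrite /=; lia.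
Qed.

(** * Values and welfares of bundles *)

Lemma value_ge0 i S : 0 <= value i S.
Proof. by apply: sumr_ge0 => e _; apply: item_val_ge0. Qed.

Lemma value_setC i S : value i (~: S)%SET = 1 - value i S.
Proof.
rewrite -(item_val_norm I i) (bigID [in S]) /= addrC /value addrK.
by apply: eq_bigl => e; rewrite inE.
Qed.

Lemma value_le1 i S : value i S <= 1.
Proof. by rewrite -subr_ge0 -value_setC value_ge0. Qed.

Lemma value_prefix_mono i k l :
  (k <= l)%N -> value i (prefix_set k) <= value i (prefix_set l).
Proof.
move=> kl; rewrite /value [leRHS](bigID [in prefix_set k]) /=.
rewrite [X in _ <= X + _](eq_bigl [in prefix_set k]) => [|e].
  by rewrite lerDl sumr_ge0 // => e _; apply: item_val_ge0.
by rewrite !inE; lia.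
Qed.

Lemma value_prefix0 i : value i (prefix_set 0) = 0.
Proof. by apply: big_pred0 => e; rewrite inE. Qed.

Lemma value_prefix_full i : value i (prefix_set m) = 1.
Proof.
rewrite -(item_val_norm I i); apply: eq_bigl => e.
by rewrite inE ltn_ord.
Qed.

Lemma UWE i A : UW A = value i (A i) + value (rev_ord i) (A (rev_ord i)).
Proof.
have [->|->] := agent_cases i; first by rewrite rev_agent1.
by rewrite -rev_agent1 rev_ordK rev_agent1 addrC.
Qed.

Lemma EW_ge A x : (x <= EW A) = [forall i, x <= value i (A i)].
Proof.
rewrite le_min; apply/andP/forallP => [[h1 h2]|h]; last by [].
apply: (@agentP (fun i => x <= value i (A i)) agent1) => //.
by rewrite (_ : rev_ord _ = agent2) //; apply/val_inj.
Qed.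

Lemma EW_le i A : EW A <= value i (A i).
Proof. by move: i; apply/forallP; rewrite -EW_ge. Qed.

Lemma EW_ge0 A : 0 <= EW A.
Proof. by rewrite EW_ge; apply/forallP => i; apply: value_ge0. Qed.

Lemma UW_ge0 A : 0 <= UW A.
Proof. by rewrite addr_ge0 ?value_ge0. Qed.

(** The cut at [0] shows that some allocation exists, and nonnegativity keeps the default value [0]
    from exceeding the true maximum. *)
Lemma bigmax_allocation (f : bundles I -> R) : (forall A, 0 <= f A) ->
  exists2 A, is_allocation A & \big[Num.max/0]_(A | is_allocation A) f A = f A.
Proof.
move=> f0; have A0 : is_allocation (cut agent1 0) by apply: cut_allocation.
exists [arg max_(A > cut agent1 0 | is_allocation A) f A]%O.
  by case: arg_maxP.
exact: bigmax_eq_arg.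
Qed.

Lemma le_OPT (W : welfare R) A : is_allocation A -> W I A <= OPT W I.
Proof. exact: (le_bigmax_cond _ (fun A => W I A)). Qed.

Lemma OPT_ge0 (W : welfare R) : 0 <= OPT W I.
Proof. exact: bigmax_ge_id. Qed.

Lemma UW_le1D A i : UW A <= 1 + value i (A i).
Proof. by rewrite (UWE i) addrC lerD2r value_le1. Qed.

(* Cut where the agent with the larger share would, and orient the two parts so
   that the utilitarian welfare is at least 1: the other agent then values her
   part at least as much as the first agent does. *)
Lemma MMS_allocation : exists A,
  [/\ is_allocation A, 1 <= UW A & forall i, MMS_share I i <= EW A].
Proof.
have [i imax] : exists i, forall j, MMS_share I j <= MMS_share I i.
  exists [arg max_(i > agent1) MMS_share I i]%O.
  by case: arg_maxP => // i _ h j; apply: h.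
have [X aX EX] :
    exists2 X : bundles I, is_allocation X & MMS_share I i =
      Num.min (value i (X agent1)) (value i (X agent2)).
  apply: (@bigmax_allocation (fun X => Num.min (value i (X agent1)) _)) => A.
  by rewrite le_min !value_ge0.
have [j [k [km XE]]] := allocation_cut aX; rewrite {}XE in EX.
have share_le l : MMS_share I i <= value i (cut j k l).
  by rewrite EX ge_min; have [->|->] := agent_cases l; rewrite lexx ?orbT.
(* Either side of this cut meets the share of agent [i], so the orientation remains free. *)
have both : MMS_share I i <= value i (prefix_set k) /\
            MMS_share I i <= value i (~: prefix_set k)%SET.
  by split; [rewrite -(cutE j k)|rewrite -(cut_rev j k)].
have [l uw] : exists l, 1 <= UW (cut l k).
  case: (lerP 1 (UW (cut i k))) => [h|b]; first by exists i.
  exists (rev_ord i); move: b; rewrite !(UWE i) !cutE cut_rev cut_revl.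
  rewrite !value_setC; lra.
have {both} cutl a : MMS_share I i <= value i (cut l k a).
  by case: both => b1 b2; rewrite ffunE; case: ifP.
exists (cut l k); split => //; first exact: cut_allocation.
move=> a; apply: le_trans (imax a) _; rewrite EW_ge; apply/forallP.
apply: (@agentP _ i) => //; apply: le_trans (cutl (rev_ord i)) _.
(* Subtracting this from [1 <= UW] compares both agents' values of the other agent's part. *)
have : value i (cut l k i) + value i (cut l k (rev_ord i)) = 1.
  move: (value_setC i (prefix_set k)); rewrite !ffunE.
  have [<-|ne] := eqVneq i l; first by rewrite rev_ord_neq; lra.
  have -> : rev_ord i == l; last by lra.
  apply/eqP; move: ne.
  by apply: (@agentP (fun l => i != l -> rev_ord i = l) i); rewrite ?eqxx.
move: uw; rewrite (UWE i); lra.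
Qed.

Lemma EW_MMS : exists A,
  [/\ is_allocation A, MMS A & OPT (@EW R) I = EW A].
Proof.
have [A aA EA] := bigmax_allocation EW_ge0; exists A; split => //.
have [B [aB _ hB]] := MMS_allocation.
apply/forallP => i; apply: le_trans (hB i) _.
by apply: le_trans (le_OPT (@EW R) aB) _; rewrite /OPT EA EW_le.
Qed.

(* If the optimal allocation is unfair to an agent, that agent gets less than
   1/2, so the optimum is below 3/2. *)
Lemma UW_fair (F : fairness R) :
  (forall A, (forall i, 2^-1 <= value i (A i)) -> F I A) ->
  (exists A, [/\ is_allocation A, F I A & 1 <= UW A]) ->
  exists A, [/\ is_allocation A, F I A & OPT (@UW R) I <= 3 / 2 * UW A].
Proof.
move=> Fhalf [B [aB FB uB]].
have [A aA EA] := bigmax_allocation UW_ge0.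
case: (boolP (F I A)) => FA.
  by exists A; split => //; rewrite /OPT EA; have := UW_ge0 A; lra.
exists B; split => //; rewrite /OPT EA.
have /existsP [i] : [exists i, ~~ (2^-1 <= value i (A i))].
  by rewrite -negb_forall; apply: contra FA => /forallP; apply: Fhalf.
by have := UW_le1D A i; lra.
Qed.

Lemma MMS_share_le_half i : MMS_share I i <= 2^-1.
Proof.
apply: bigmax_le => [|A /is_allocationP [e _]]; first by rewrite invr_ge0.
by rewrite e value_setC ge_min; lra.
Qed.

Lemma UW_MMS :
  exists A, [/\ is_allocation A, MMS A & OPT (@UW R) I <= 3 / 2 * UW A].
Proof.
apply: UW_fair => [A h|].
  by apply/forallP => i; apply: le_trans (MMS_share_le_half i) _.
have [A [aA uA hA]] := MMS_allocation; exists A; split => //.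
by apply/forallP => i; apply: le_trans (hA i) (EW_le i A).
Qed.

(** * Median items and PROP1 *)

Definition is_median i k :=
  value i (prefix_set k) < 2^-1 <= value i (prefix_set k.+1).

Lemma median_exists i : exists2 k, (k < m)%N & is_median i k.
Proof.
have ex : exists k, 2^-1 <= value i (prefix_set k).
  by exists m; rewrite value_prefix_full; lra.
have := ex_minnP ex => -[[|k]] h hmin.
  by move: h; rewrite value_prefix0; lra.
exists k; last first.
  by rewrite /is_median h andbT ltNge; apply/negP => /hmin; rewrite ltnn.
by apply: hmin; rewrite value_prefix_full; lra.
Qed.

Lemma half_PROP1 A : (forall i, 2^-1 <= value i (A i)) -> PROP1 A.
Proof. by move=> h; apply/forallP => i; rewrite h. Qed.

(** If the medians differ, the agent with the earlier one takes everything up to and including it.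
    What remains contains the other agent's median and all items after it, worth more than 1/2 to
    her. *)
Lemma median_split :
  (exists2 A : bundles I, is_allocation A & forall i, 2^-1 <= value i (A i)) \/
  (exists2 k, (k < m)%N & forall i, is_median i k).
Proof.
have [i [k [l [km lm ki li kl]]]] : exists i k l,
    [/\ (k < m)%N, (l < m)%N, is_median i k, is_median (rev_ord i) l &
        (k <= l)%N].
  have [k km ki] := median_exists agent1.
  have [l lm li] := median_exists (rev_ord agent1).
  case: (leqP k l) => [kl|/ltnW lk]; first by exists agent1, k, l.
  by exists (rev_ord agent1), l, k; rewrite rev_ordK.
move: kl; rewrite leq_eqVlt => /orP [/eqP kl|kl].
  by right; exists k => //; apply: (@agentP _ i) => //; rewrite kl.
left; exists (cut i k.+1); first exact: cut_allocation.
move/andP: ki => [_ ki]; move/andP: li => [li _].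
apply: (@agentP _ i); first by rewrite cutE.
rewrite cut_rev value_setC.
by have := value_prefix_mono (rev_ord i) kl; lra.
Qed.

Lemma setU1_prefix k (km : (k < m)%N) :
  (Ordinal km |: prefix_set k)%SET = prefix_set k.+1.
Proof. by apply/setP => e; rewrite !inE -val_eqE /=; lia. Qed.

Lemma setU1_suffix k (km : (k < m)%N) :
  (Ordinal km |: ~: prefix_set k.+1)%SET = (~: prefix_set k)%SET.
Proof. by apply/setP => e; rewrite !inE -val_eqE /=; lia. Qed.

(** The part containing item [k] is worth at least 1/2 to either agent; the other part is adjacent
    to [k] and reaches 1/2 once [k] is added. *)
Lemma median_PROP1 k l i : (k < m)%N -> (forall j, is_median j k) ->
  l = k \/ l = k.+1 -> PROP1 (cut i l).
Proof.
move=> km med hl; apply/forallP => j.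
have /andP [lo hi] := med j; rewrite ffunE.
have co : 2^-1 <= value j (~: prefix_set k)%SET by rewrite value_setC; lra.
case: hl => ->; case: ifP => _; rewrite ?hi ?co //; apply/orP; right.
  apply/existsP; exists (Ordinal km).
  by rewrite setU1_prefix hi prefix_connected // inE /= ltnn.
apply/existsP; exists (Ordinal km).
by rewrite setU1_suffix co suffix_connected ?(ltnW km) // !inE /= ltnS leqnn.
Qed.

Lemma EW_PROP1 : exists A,
  [/\ is_allocation A, PROP1 A & OPT (@EW R) I = EW A].
Proof.
have [A aA EA] := bigmax_allocation EW_ge0.
have max_EW B : is_allocation B -> EW A <= EW B -> OPT (@EW R) I = EW B.
  by move=> aB AB; apply/eqP; rewrite eq_le le_OPT // /OPT EA AB.
case: median_split => [[B aB hB]|[k km med]].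
  (* Here the optimal egalitarian welfare is at least 1/2. *)
  exists A; split => //; apply: half_PROP1 => i.
  apply: le_trans (EW_le i A); rewrite -EA.
  by apply: le_trans (le_OPT (@EW R) aB); rewrite EW_ge; apply/forallP.
have [i [l [lm Al]]] := allocation_cut aA.
have := EW_le i A; have := EW_le (rev_ord i) A.
rewrite {2 4}Al cutE cut_rev value_setC => EWr EWi.
have /andP [loi hii] := med i; have /andP [lor hir] := med (rev_ord i).
case: (leqP l k) => lk.
  (* The prefix owner has less than 1/2 in [A], hence so does [EW A]. Moving the cut right to [k]
     does not hurt her and leaves the other agent more than 1/2. *)
  exists (cut i k); split; [by apply/cut_allocation/ltnW|
    by apply: (median_PROP1 _ km) => //; left|].
  apply: max_EW; first by apply/cut_allocation/ltnW.
  have := value_prefix_mono i lk => mono.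
  rewrite EW_ge; apply/forallP; apply: (@agentP _ i);
    rewrite ?cutE ?cut_rev ?value_setC; lra.
(* Mirror case: the suffix owner has at most 1/2, and the cut moves left to [k.+1]. *)
exists (cut i k.+1); split; [exact: cut_allocation|
  by apply: (median_PROP1 _ km) => //; right|].
apply: max_EW; first exact: cut_allocation.
have := value_prefix_mono (rev_ord i) lk => mono.
rewrite EW_ge; apply/forallP; apply: (@agentP _ i);
  rewrite ?cutE ?cut_rev ?value_setC; lra.
Qed.

(** With a common median, both orientations of the cut before it are PROP1, and their welfares add
    up to 2. *)
Lemma UW_PROP1 :
  exists A, [/\ is_allocation A, PROP1 A & OPT (@UW R) I <= 3 / 2 * UW A].
Proof.
apply: UW_fair => [A|]; first exact: half_PROP1.
case: median_split => [[B aB hB]|[k km med]].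
  exists B; split => //; first exact: half_PROP1.
  by rewrite (UWE agent1); have := hB agent1; have := hB (rev_ord agent1); lra.
have fair i : is_allocation (cut i k) /\ PROP1 (cut i k).
  by split; [apply/cut_allocation/ltnW|apply: (median_PROP1 _ km) => //; left].
case: (lerP 1 (UW (cut agent1 k))) => [h|h].
  by exists (cut agent1 k); have [] := fair agent1.
exists (cut (rev_ord agent1) k); have [-> ->] := fair (rev_ord agent1).
split => //; move: h; rewrite (UWE agent1) (UWE (rev_ord agent1)) rev_ordK.
rewrite !cutE cut_rev cut_revl !value_setC; lra.
Qed.

End Cuts.

(** * From single instances to the price of fairness *)

Section Price.
Variable R : realType.

Lemma PoF_le (W : welfare R) (F : fairness R) (c : R) : 1 <= c ->
  (forall I A, 0 <= W I A) ->
  (forall I, exists A, [/\ is_allocation A, F I A & OPT W I <= c * W I A]) ->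
  (PoF W F <= c%:E)%E.
Proof.
move=> c1 W0 h; apply: ge_ereal_sup => _ [I _ <-].
have [A [aA FA hA]] := h I.
apply: (@le_trans _ _ (welfare_ratio (OPT W I) (W I A))).
  by apply: bigmin_le_cond; rewrite aA.
rewrite /welfare_ratio; case: eqP => [w0|/eqP w0].
  (* Zero welfare forces a zero optimum, so the ratio is [0 / 0 = 1], at most [c]. *)
  move: hA; rewrite w0 mulr0 le_eqVlt ltNge OPT_ge0 orbF => ->.
  by rewrite lee_fin.
by rewrite lee_fin ler_pdivrMr // lt_def w0 W0.
Qed.

(** The infinite cases are harmless: a fair allocation of welfare [0] has infinite ratio since the
    optimum is positive, and without fair allocations the price is [+oo]. *)
Lemma PoF_ge (W : welfare R) (F : fairness R) (I : instance R) (c : R) :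
  0 < OPT W I -> (forall A, 0 <= W I A) ->
  (forall A, is_allocation A -> F I A -> c * W I A <= OPT W I) ->
  (c%:E <= PoF W F)%E.
Proof.
move=> opt0 W0 h; apply: (@le_trans _ _ (instance_price W F I)); last first.
  by apply: ereal_sup_ubound; exists I.
apply: le_bigmin => [|A /andP [aA FA]]; first exact: leey.
rewrite /welfare_ratio; case: eqP => [w0|/eqP w0].
  by rewrite gt_eqF // leey.
by rewrite lee_fin ler_pdivlMr ?h // lt_def w0 W0.
Qed.

(** * The three-item family approaching 3/2 *)

Section Example.
Variables (d : R) (d0 : 0 < d) (d1 : d < 1 / 4).

(* The only allocation of utilitarian welfare close to 3/2 gives the first item
   to agent 1 and the rest to agent 2; it is neither MMS nor PROP1. *)
Definition example_val (i : 'I_2) (e : 'I_3) : R :=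
  if i == agent1 then [:: 2^-1 - 2 * d; d; 2^-1 + d]`_e
  else [:: 0; 2^-1; 2^-1]`_e.

Lemma example_val_ge0 i e : 0 <= example_val i e.
Proof.
move: d0 d1 => ? ?; rewrite /example_val.
by case: ifP => _; case: e => [[|[|[|//]]] h] /=; lra.
Qed.

Lemma example_val_norm i : \sum_e example_val i e = 1.
Proof.
rewrite /example_val; case: (i == agent1);
  rewrite !big_ord_recl big_ord0 /=; lra.
Qed.

Definition example : instance R :=
  Instance example_val_ge0 example_val_norm.

(** The lists serve [k <= 2]; beyond them the lookup defaults to [0] and the last summand supplies
    the full value [1]. *)
Lemma example_prefix i k : value i (prefix_set example k) =
  if i == agent1
  then [:: 0; 2^-1 - 2 * d; 2^-1 - d]`_k + (2 < k)%N%:R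
  else [:: 0; 0; 2^-1]`_k + (2 < k)%N%:R.
Proof.
rewrite /value; under eq_bigl do rewrite inE.
rewrite big_mkcond !big_ord_recl big_ord0 /= /example_val.
by case: (i == agent1); case: k => [|[|[|k]]] /=; rewrite ?nth_nil; lra.
Qed.

Lemma example_OPT : 3 / 2 - 2 * d <= OPT (@UW R) example.
Proof.
move: d0 d1 => ? ?.
apply: (@le_trans _ _ (UW (cut example agent1 1))).
  rewrite (UWE agent1) cutE cut_rev value_setC !example_prefix /=; lra.
by apply: (le_OPT (@UW R)); apply: cut_allocation.
Qed.

(** The bound [1 + d] is attained by giving agent 2 the first two items; the six other oriented cuts
    have welfare at most 1. *)
Lemma example_UW A : is_allocation A ->
  A = cut example agent1 1 \/ UW A <= 1 + d.
Proof.
move: d0 d1 => ? ?.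
move=> /allocation_cut [i [k [km ->]]].
have := agent_cases i; rewrite -rev_agent1 => -[->|->].
- case: k km => [|[|[|[|//]]]] _; first 2 [by left] || right;
    rewrite (UWE agent1) cutE cut_rev value_setC !example_prefix /=; lra.
- right; rewrite (UWE (rev_ord agent1)) rev_ordK cutE.
  rewrite cut_revl value_setC !example_prefix /=.
  case: k km => [|[|[|[|//]]]] _ /=; lra.
Qed.

(** Cutting after the second item would secure agent 1 [2^-1 - d], but the first item is worth only
    [2^-1 - 2 * d] to her. *)
Lemma example_MMS : ~~ MMS (cut example agent1 1).
Proof.
move: d0 d1 => ? ?.
apply/negP => /forallP /(_ agent1); apply/negP; rewrite -ltNge cutE.
apply: (@lt_le_trans _ _ (2^-1 - d)); first by rewrite example_prefix /=; lra.
apply: le_trans (le_bigmax_cond _ _ (@cut_allocation _ example agent1 2 isT)).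
rewrite le_min cutE -rev_agent1 cut_rev value_setC example_prefix /=; lra.
Qed.

(** Agent 1 can only add the middle item, which yields [2^-1 - d]; adding the last one would leave a
    gap. *)
Lemma example_PROP1 : ~~ PROP1 (cut example agent1 1).
Proof.
move: d0 d1 => ? ?.
apply/negP => /forallP /(_ agent1); rewrite cutE => /orP [|/existsP [e]].
  by rewrite example_prefix /=; lra.
case: e => [[|[|[|//]]] h] /and3P [].
- by rewrite inE.
- by rewrite (setU1_prefix (I := example)) example_prefix /=; lra.
- move=> _ /existsP [a /existsP [b /eqP /setP E]].
  have := E (Ordinal (isT : 0 < 3)%N); have := E (Ordinal (isT : 1 < 3)%N).
  have := E (Ordinal (isT : 2 < 3)%N); rewrite !inE -!val_eqE /=; lia.
Qed.

End Example.

(** Any instance with positive optimum works, since no allocation beats the optimum. In [example]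
    the cut after two items gives each agent at least 1/4. *)
Lemma PoF_EW_ge1 (F : fairness R) : (1 <= PoF (@EW R) F)%E.
Proof.
have [d d0 d1] : exists2 d : R, 0 < d & d < 1 / 4 by exists (1 / 8); lra.
apply: (@PoF_ge _ _ (example d0 d1)) => [|A|A aA _].
- apply: (@lt_le_trans _ _ (EW (cut (example d0 d1) agent1 2))); last first.
    exact/(le_OPT (@EW R))/cut_allocation.
  apply: (@lt_le_trans _ _ (1/4)); first by lra.
  rewrite EW_ge; apply/forallP; apply: (@agentP _ agent1);
    rewrite ?cutE ?cut_rev ?value_setC example_prefix /=; lra.
- exact: EW_ge0.
- by rewrite mul1r; apply: (le_OPT (@EW R)).
Qed.

Lemma PoF_UW_ge (F : fairness R) :
  (forall d (d0 : 0 < d) (d1 : d < 1 / 4),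
     ~~ F _ (cut (example d0 d1) agent1 1)) ->
  ((3 / 2)%:E <= PoF (@UW R) F)%E.
Proof.
move=> notF; apply/lee_addgt0Pr => e e0.
(* The bound [e / 4] yields [(3 / 2 - e) * (1 + d) <= 3 / 2 - 2 * d], which compares fair welfare
   with the optimum; [1 / 8] ensures [d < 1 / 4]. *)
pose d := Num.min (e / 4) (1 / 8).
have d0 : 0 < d by rewrite lt_min; apply/andP; split; lra.
have de : d <= e / 4 by rewrite ge_min lexx.
have d8 : d <= 1 / 8 by rewrite ge_min lexx orbT.
have d1 : d < 1 / 4 by lra.
rewrite -leeBlDr // -EFinB.
have opt := example_OPT d0 d1.
apply: (@PoF_ge _ _ (example d0 d1)) => [|A|A aA FA].
- by lra.
- exact: UW_ge0.
have [EA|uA] := example_UW aA.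
  by have := notF _ d0 d1; rewrite -EA FA.
apply: le_trans opt; have := UW_ge0 A; nra.
Qed.

End Price.

Theorem theorem24 (R : realType) :
  [/\ PoF (@EW R) (@MMS R) = 1%E,
      PoF (@EW R) (@PROP1 R) = 1%E,
      PoF (@UW R) (@MMS R) = (3 / 2 : R)%:E &
      PoF (@UW R) (@PROP1 R) = (3 / 2 : R)%:E].
Proof.
split; apply/eqP; rewrite eq_le; apply/andP; split.
- apply: PoF_le => // [I A|I]; first exact: EW_ge0.
  by have [A [aA FA E]] := EW_MMS I; exists A; rewrite mul1r E.
- exact: PoF_EW_ge1.
- apply: PoF_le => // [I A|I]; first exact: EW_ge0.
  by have [A [aA FA E]] := EW_PROP1 I; exists A; rewrite mul1r E.
- exact: PoF_EW_ge1.
- apply: PoF_le => [|I A|I]; [lra|exact: UW_ge0|exact: UW_MMS].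
- by apply: PoF_UW_ge => d d0 d1; apply: example_MMS.
- apply: PoF_le => [|I A|I]; [lra|exact: UW_ge0|exact: UW_PROP1].
- by apply: PoF_UW_ge => d d0 d1; apply: example_PROP1.
Qed.
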